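(* Let $M\leq N$ be positive integers and let $U$ be the $N\times N$ non-normalized discrete Fourier transform matrix, $U_{k\ell}:=\mathrm{e}^{2\pi\mathrm{i}k\ell/N}$ for $k,\ell=0,\ldots,N-1$. Let $\{B_i\}_{i=0}^{N-1}$ be independent Bernoulli random variables with mean $\frac{M}{N}$, and let $\mathcal{M}:=\{i:B_i=1\}$. Let $F$ be the $|\mathcal{M}|\times N$ matrix obtained by collecting the rows of $U$ with indices in $\mathcal{M}$ and normalizing the resulting columns to have unit norm. Then, whenever $\mathcal{M}\neq\emptyset$, $F$ is a unit norm tight frame: $\|F\|_2^2=\frac{N}{|\mathcal{M}|}$. Furthermore, provided $16\log N\leq M\leq\frac{N}{3}$, the following inequalities simultaneously hold with probability exceeding $1-4N^{-1}-N^{-2}$: (i) $\frac12 M\leq|\mathcal{M}|\leq\frac32 M$, (ii) $\nu_F\leq\frac{\mu_F}{\sqrt{|\mathcal{M}|}}$, (iii) $\mu_F\leq\sqrt{\frac{118(N-M)\log N}{MN}}$.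
   Context: $\log$ is the natural logarithm and $\|F\|_2$ is the spectral norm. A (finite-dimensional) frame is an $m\times N$ matrix of rank $m$, whose columns are called the frame elements; it is unit norm if all columns have Euclidean norm $1$. It is tight if $\sum_{n=1}^N|\langle x,f_n\rangle|^2=A\|x\|^2$ for some $A>0$ and all $x$; for an $m\times N$ unit norm frame this is equivalent to $\|F\|_2^2=\frac{N}{m}$. For a unit norm frame $F$ with columns $f_1,\ldots,f_N$, the worst-case coherence is $\mu_F:=\max_{i\neq j}|\langle f_i,f_j\rangle|$ and the average coherence is $\nu_F:=\frac{1}{N-1}\max_{i\in\{1,\ldots,N\}}\big|\sum_{j\neq i}\langle f_i,f_j\rangle\big|$, where $i,j$ range over $\{1,\ldots,N\}$. *)

(* Defs.v *)
(* MathComp-Analysis, with the complex numbers R[i] of real-closed. *)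
From HB Require Import structures.
From mathcomp Require Export all_boot all_order all_algebra.
From mathcomp Require Export all_classical all_reals all_analysis.
From mathcomp Require Export complex.

Set Implicit Arguments.
Unset Strict Implicit.
Unset Printing Implicit Defensive.

Import Order.TTheory GRing.Theory Num.Theory.

Local Open Scope classical_set_scope.
Local Open Scope ring_scope.

Section Frames.
Variable R : realType.

(* [dotmx] is defined on row vectors and conjugates its second argument. *)
Definition inner (m : nat) (x y : 'cV[R[i]]_m) : R[i] := dotmx x^T y^T.

Definition l2norm (m : nat) (x : 'cV[R[i]]_m) : R :=
  Num.sqrt (\sum_(k < m) Normc.normc (x k 0) ^+ 2).

Definition spectral_norm (m N : nat) (F : 'M[R[i]]_(m, N)) : R :=
  sup [set l2norm (F *m x) | x in [set x : 'cV[R[i]]_N | l2norm x <= 1]].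

Definition is_frame (m N : nat) (F : 'M[R[i]]_(m, N)) : Prop := \rank F = m.

Definition unit_norm (m N : nat) (F : 'M[R[i]]_(m, N)) : Prop :=
  forall n : 'I_N, l2norm (col n F) = 1.

Definition tight (m N : nat) (F : 'M[R[i]]_(m, N)) : Prop :=
  exists A : R, 0 < A /\
    forall x : 'cV[R[i]]_m,
      \sum_(n < N) Normc.normc (inner x (col n F)) ^+ 2 = A * l2norm x ^+ 2.

(* The maxima below are taken over nonnegative reals, so starting them at 0 is
   harmless; it only fixes the value 0 when there is no index to range over. *)
Definition worst_case_coherence (m N : nat) (F : 'M[R[i]]_(m, N)) : R :=
  \big[Num.max/0]_(i < N) \big[Num.max/0]_(j < N | j != i)
    Normc.normc (inner (col i F) (col j F)).

Definition average_coherence (m N : nat) (F : 'M[R[i]]_(m, N)) : R :=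
  (N%:R - 1)^-1 *
    \big[Num.max/0]_(i < N)
      Normc.normc (\sum_(j < N | j != i) inner (col i F) (col j F)).

(* The entry is exp(2 pi i k l / N), written out by Euler's formula. *)
Definition dft (N : nat) : 'M[R[i]]_N :=
  \matrix_(k < N, l < N)
    let t : R := 2 * pi * k%:R * l%:R / N%:R in (cos t +i* sin t)%C.

Definition normalize_cols (m N : nat) (A : 'M[R[i]]_(m, N)) :
    'M[R[i]]_(m, N) :=
  \matrix_(k < m, n < N) (A k n / ((l2norm (col n A))%:C)%C).

Definition harmonic_frame (N : nat) (S : {set 'I_N}) : 'M[R[i]]_(#|S|, N) :=
  normalize_cols (rowsub (fun k : 'I_#|S| => enum_val k) (dft N)).

End Frames.

Section Randomness.
Context (d : measure_display) (T : measurableType d) (R : realType).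
Variable P : probability T R.

Definition mutually_independent (I : finType) (d' : measure_display)
    (T' : measurableType d') (X : I -> {RV P >-> T'}) : Prop :=
  forall (J : {set I}) (A : I -> set T'), (forall i, measurable (A i)) ->
    (P (\bigcap_(i in [set` J]) (X i @^-1` A i))
     = \prod_(i in J) P (X i @^-1` A i))%E.

(* The value 1 of a Bernoulli variable is encoded by [true]; its mean is the
   parameter p. *)
Definition bernoulli_RV (p : R) (X : {RV P >-> bool}) : Prop :=
  distribution P X = bernoulli_prob p :> (set bool -> \bar R).

Definition random_index_set (N : nat) (B : 'I_N -> {RV P >-> bool}) (w : T) :
    {set 'I_N} :=
  [set i | B i w]%SET.

End Randomness.

(* Main.v *)
Require Import Defs.
From mathcomp Require Import ring lra.

(* The columns of the DFT matrix are orthogonal (geometric sums), so F F^* =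
   (N / |S|) I, which gives the frame, tightness and norm claims.

   For the probabilistic part, |S| - M and the real and imaginary parts of
   |S| <f_i, f_j> (i <> j) are all of the form sum_k c_k (B_k - M / N) with
   |c_k| <= 1, because the columns of the DFT matrix other than the zeroth
   have zero sum. The Chernoff bound with e^x <= 1 + x + x^2 gives P (|X| >=
   s) <= 2 exp (l^2 v - l s) with v = M (N - M) / N. Taking l = 1/4 and s =
   M/2 makes (i) fail with probability at most 2 / N, and a union bound over
   the 2 N^2 real and imaginary parts makes (iii) fail with probability at
   most 2 / N. Finally (ii) follows from (i) alone: the row sums of the Gram
   matrix are 0 or N / |S|, so nu <= (N / |S| - 1) / (N - 1) as soon as |S|
   <= N / 2, and the Welch bound mu^2 >= (N / |S| - 1) / (N - 1) concludes. *)

Set Implicit Arguments.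
Unset Strict Implicit.
Unset Printing Implicit Defensive.

Import Order.TTheory GRing.Theory Num.Theory.

Local Open Scope classical_set_scope.
Local Open Scope ring_scope.

(** * Random subsets with independent Bernoulli memberships *)

Lemma expR_le_quadratic (R : realType) (x : R) :
  x <= 3 / 5 -> expR x <= 1 + x + x ^+ 2.
Proof.
move=> hx.
(* e^y <= 1/(1 - y) at y = x/3, cubed *)
have h3 : expR x * (1 - x / 3) ^+ 3 <= 1.
  have -> : expR x = expR (x / 3) ^+ 3.
    by rewrite -expRM_natl; congr expR; field.
  rewrite -exprMn exprn_ile1//.
    by rewrite mulr_ge0 ?expR_ge0//; lra.
  rewrite -[leRHS](expRxMexpNx_1 (x / 3)) ler_wpM2l ?expR_ge0//.
  by have := expR_ge1Dx (- (x / 3)); lra.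
have h0 : 0 < (1 - x / 3) ^+ 3 by rewrite exprn_gt0//; lra.
rewrite -(ler_pM2r h0); apply: (le_trans h3).
rewrite -subr_ge0.
(* The factorization exhibits the sign: the inner quadratic has negative discriminant and
   [3 / 5 - x] is nonnegative. *)
have -> : (1 + x + x ^+ 2) * (1 - x / 3) ^+ 3 - 1
  = x ^+ 2 * ((3 / 5 - x) * (x ^+ 2 - 37 / 5 * x + 364 / 25) + 33 / 125) / 27.
  by field.
by rewrite divr_ge0// mulr_ge0 ?sqr_ge0//; nra.
Qed.

(** * Chernoff bounds for weighted sums of independent centered Bernoulli variables *)

Section BernoulliLaw.
Variables (R : realType) (I : finType) (p : R).
Hypothesis p01 : 0 <= p <= 1.

Let p0 : 0 <= p. Proof. by case/andP: p01. Qed.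
Let q0 : 0 <= 1 - p. Proof. by case/andP: p01 => _; rewrite subr_ge0. Qed.

(** The law of the random set as a weight on subsets, so that all tail estimates are finite sums;
    the probability space enters only through [prob_random_index_set]. *)
Definition bernoulli_law (A : {set I}) : R :=
  \prod_i (if i \in A then p else 1 - p).

Lemma bernoulli_law_ge0 A : 0 <= bernoulli_law A.
Proof. by apply: prodr_ge0 => i _; case: ifP. Qed.

Lemma bernoulli_law_total : \sum_A bernoulli_law A = 1.
Proof.
by rewrite -bigA_distr big1// => i _; rewrite /= addrC subrK.
Qed.

Definition centered_sum (c : I -> R) (A : {set I}) : R :=
  \sum_i c i * ((i \in A)%:R - p).

(** The product form of the law factors the sum over indices. In each factor the quadratic bound on
    the exponential makes the linear terms cancel and leaves
    [1 + l ^+ 2 * (p * (1 - p)) * c i ^+ 2], which is at most an exponential again. *)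
Lemma bernoulli_law_mgf (c : I -> R) (l : R) :
  (forall i, `|c i| <= 1) -> 0 <= l <= 3 / 5 ->
  \sum_A bernoulli_law A * expR (l * centered_sum c A)
    <= expR (l ^+ 2 * (#|I|%:R * (p * (1 - p)))).
Proof.
move=> c1 l01.
have -> : \sum_A bernoulli_law A * expR (l * centered_sum c A) =
  \prod_i (p * expR (l * (c i * (1 - p))) + (1 - p) * expR (l * (c i * - p))).
  rewrite bigA_distr; apply: eq_bigr => A _.
  rewrite /centered_sum mulr_sumr expR_sum -big_split/=.
  by apply: eq_bigr => i _; case: ifP => _ //; rewrite sub0r.
have -> : l ^+ 2 * (#|I|%:R * (p * (1 - p)))
  = \sum_(i : I) l ^+ 2 * (p * (1 - p)).
  by rewrite sumr_const cardT -cardE mulrCA mulr_natl.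
rewrite expR_sum; apply: ler_prod => i _.
case/andP: l01 => l0 l1.
rewrite addr_ge0 ?mulr_ge0 ?expR_ge0//=.
have e q : `|q| <= 1 ->
    expR (l * (c i * q)) <= 1 + l * (c i * q) + (l * (c i * q)) ^+ 2.
  move=> q1; apply: expR_le_quadratic; apply: le_trans l1.
  rewrite ler_piMr// (le_trans (ler_norm _))// normrM mulr_ile1//.
have e1 := e (1 - p); have e2 := e (- p).
rewrite normrN !ger0_norm// in e1 e2.
have p1 : p <= 1 by case/andP: p01.
have q1 : 1 - p <= 1 by rewrite lerBlDr lerDl.
move: e1 e2 => /(_ q1) e1 /(_ p1) e2.
apply: le_trans (expR_ge1Dx _).
apply: le_trans (lerD (ler_wpM2l p0 e1) (ler_wpM2l q0 e2)) _.
have -> : p * (1 + l * (c i * (1 - p)) + (l * (c i * (1 - p))) ^+ 2) +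
  (1 - p) * (1 + l * (c i * - p) + (l * (c i * - p)) ^+ 2)
  = 1 + l ^+ 2 * (p * (1 - p)) * c i ^+ 2 by ring.
rewrite lerD2l ler_piMr//; first by rewrite mulr_ge0 ?sqr_ge0 ?mulr_ge0.
by rewrite -real_normK ?num_real ?exprn_ile1.
Qed.

(** Exponential Markov inequality: on the event, [expR (l * s)] is at most
    [expR (l * centered_sum c A)]. *)
Lemma bernoulli_law_tail (c : I -> R) (l s : R) :
  (forall i, `|c i| <= 1) -> 0 <= l <= 3 / 5 ->
  \sum_(A | s <= centered_sum c A) bernoulli_law A
    <= expR (l ^+ 2 * (#|I|%:R * (p * (1 - p))) - l * s).
Proof.
move=> c1 l01.
rewrite expRD -ler_pdivrMr ?expR_gt0// -expRN opprK.
apply: le_trans (bernoulli_law_mgf c1 l01).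
rewrite mulr_suml [leRHS](bigID (fun A => s <= centered_sum c A))/=.
apply: ler_wpDr.
  by apply: sumr_ge0 => A _; rewrite mulr_ge0 ?bernoulli_law_ge0 ?expR_ge0.
apply: ler_sum => A sA; rewrite ler_wpM2l ?bernoulli_law_ge0// ler_expR.
by rewrite ler_wpM2l//; lra.
Qed.

Lemma bernoulli_law_norm_tail (c : I -> R) (l s : R) :
  (forall i, `|c i| <= 1) -> 0 <= l <= 3 / 5 ->
  \sum_(A | s <= `|centered_sum c A|) bernoulli_law A
    <= 2 * expR (l ^+ 2 * (#|I|%:R * (p * (1 - p))) - l * s).
Proof.
move=> c1 l01.
have Nc1 i : `|- c i| <= 1 by rewrite normrN.
rewrite mulr_natl mulr2n.
apply: le_trans (lerD (bernoulli_law_tail s c1 l01)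
                      (bernoulli_law_tail s Nc1 l01)).
rewrite [X in X + _]big_mkcond [X in _ + X]big_mkcond -big_split/=.
rewrite big_mkcond/=; apply: ler_sum => A _.
have -> : centered_sum (fun i => - c i) A = - centered_sum c A.
  by rewrite /centered_sum -sumrN; apply: eq_bigr => i _; rewrite mulNr.
have w0 := bernoulli_law_ge0 A.
case: ifP => [|_]; last by case: ifP; case: ifP; lra.
by rewrite lerNr ler_normr lerNr; case/orP => ->; case: ifP => _; lra.
Qed.

Lemma bernoulli_law_union (J : finType) (Q : pred {set I})
    (E : J -> pred {set I}) :
  (forall A, Q A -> exists j, E j A) ->
  \sum_(A | Q A) bernoulli_law A
    <= \sum_j \sum_(A | E j A) bernoulli_law A.
Proof.
move=> QE; under [leRHS]eq_bigr do rewrite big_mkcond.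
rewrite exchange_big big_mkcond/=; apply: ler_sum => A _.
have w0 := bernoulli_law_ge0 A.
case: ifP => [/QE[j EjA]|_].
  rewrite (bigD1 j)//= EjA lerDl; apply: sumr_ge0 => k _.
  by case: ifP.
by apply: sumr_ge0 => k _; case: ifP.
Qed.

End BernoulliLaw.

(** Centering costs nothing when the coefficients have zero total, as for the Fourier phases; for
    [c = 1] it subtracts the mean size. *)
Lemma centered_sumE (R : realType) (I : finType) (p : R) (c : I -> R) A :
  centered_sum p c A = \sum_(i in A) c i - p * \sum_i c i.
Proof.
rewrite /centered_sum mulr_sumr [X in _ = X - _]big_mkcond -sumrB/=.
apply: eq_bigr => i _.
by rewrite mulrBr (mulrC p); case: ifP => _; rewrite ?mulr1 ?mulr0.
Qed.

(** * Transfer from the probability space to the law on subsets *)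

Section RandomSet.
Context (d : measure_display) (T : measurableType d) (R : realType).
Variables (P : probability T R) (N : nat) (p : R) (B : 'I_N -> {RV P >-> bool}).
Hypothesis p01 : 0 <= p <= 1.
Hypothesis indepB : mutually_independent B.
Hypothesis bernB : forall i, bernoulli_RV p (B i).

Let fiber (A : {set 'I_N}) : set T := [set w | random_index_set B w = A].

(** Intersecting over the full index set gives the shape to which [mutually_independent] applies. *)
Lemma fiberE A : fiber A =
  \bigcap_(i in [set` [set: 'I_N]%SET]) (B i @^-1` [set (i \in A)]).
Proof.
apply/seteqP; split => [w <- i _|w wA] /=; first by rewrite inE.
apply/setP => i; rewrite inE; apply: wA => /=; exact: finset.in_setT.
Qed.

Lemma measurable_fiber A : measurable (fiber A).
Proof.
rewrite fiberE; apply: fin_bigcap_measurable => // i _.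
by rewrite -[X in measurable X]setTI; exact: measurable_funPT.
Qed.

Lemma prob_fiber A : P (fiber A) = (bernoulli_law p A)%:E.
Proof.
rewrite fiberE indepB// /bernoulli_law -prodEFin.
rewrite (eq_bigl xpredT); last by move=> i; rewrite finset.in_setT.
apply: eq_bigr => i _.
have -> : P (B i @^-1` [set (i \in A)]) = bernoulli_prob p [set (i \in A)].
  by rewrite -(bernB i).
rewrite bernoulli_probE// !diracE.
by case: (i \in A); rewrite !in_set1/= ?mule1 ?mule0 ?adde0 ?add0e.
Qed.

(** There are finitely many subsets, so any event about the random set is a finite disjoint union of
    measurable fibers. *)
Lemma random_index_setE (Q : set {set 'I_N}) :
  [set w | Q (random_index_set B w)] = \bigcup_(A in Q) fiber A.
Proof.
apply/seteqP; split => [w Qw|w [A QA wA] /=]; last by rewrite wA.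
by exists (random_index_set B w).
Qed.

Lemma measurable_random_index_set (Q : set {set 'I_N}) :
  measurable [set w | Q (random_index_set B w)].
Proof.
rewrite random_index_setE; apply: fin_bigcup_measurable => // A _.
exact: measurable_fiber.
Qed.

Lemma prob_random_index_set (Q : set {set 'I_N}) :
  P [set w | Q (random_index_set B w)]
  = (\sum_(A : {set 'I_N} | `[< Q A >]) bernoulli_law p A)%:E.
Proof.
rewrite random_index_setE measure_fin_bigcup; last 3 first.
- exact: finite_finset.
- by move=> A C _ _ [w [<- <-]].
- by move=> A _; exact: measurable_fiber.
have QE : Q = [set` [seq A <- index_enum {set 'I_N} | `[< Q A >]]].
  apply/seteqP; split => A /=; rewrite mem_filter mem_index_enum andbT.
    by move=> QA; apply/asboolP.
  by move/asboolP.
rewrite [in LHS]QE -fsbig_seq ?filter_uniq ?index_enum_uniq// big_filter.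
by rewrite -sumEFin; apply: eq_bigr => A _; exact: prob_fiber.
Qed.

End RandomSet.

(** * The discrete Fourier transform *)

Section ComplexPreliminaries.
Variable R : realType.

Definition cis (t : R) : R[i] := (cos t +i* sin t)%C.

Lemma cisD s t : cis (s + t) = cis s * cis t.
Proof. by rewrite /cis cosD sinD; simpc; congr Complex; rewrite addrC. Qed.

Lemma cis0 : cis 0 = 1.
Proof. by rewrite /cis cos0 sin0. Qed.

Lemma cis_conj t : ((cis t)^*)%C = cis (- t).
Proof. by rewrite /cis cosN sinN. Qed.

Lemma cisMn t n : cis (n%:R * t) = cis t ^+ n.
Proof.
elim: n => [|n IH]; first by rewrite mul0r cis0.
by rewrite -natr1 mulrDl mul1r cisD IH exprSr.
Qed.

Lemma cis_2piM n : cis (2 * pi * n%:R) = 1.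
Proof.
by rewrite mulrC cisMn /cis mulr_natl cos2pi -[_ *+ 2]add0r sinD2pi sin0 expr1n.
Qed.

(** If [t] is nonzero, [|t| / 2] lies strictly between 0 and [pi], so its sine is positive and cos t
    = 1 - 2 sin^2 (t / 2) is below 1. *)
Lemma cis_eq1 t : `|t| < 2 * pi -> cis t = 1 -> t = 0.
Proof.
move=> t_lt [cost1 _]; apply/eqP; apply: contraTT isT => t0.
have : 0 < sin (`|t| / 2).
  by apply: sin_gt0_pi; rewrite divr_gt0 ?normr_gt0//= ltr_pdivrMr// mulrC.
have : cos `|t| = 1 by case: (ger0P t) => _; rewrite ?cosN.
rewrite {1}(_ : `|t| = (`|t| / 2) *+ 2); last by rewrite -mulr_natr divfK.
rewrite cos_mulr2n cos2sin2 => h sp.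
by have := exprn_gt0 2 sp; lra.
Qed.

Lemma normc_sqr (z : R[i]) :
  Normc.normc z ^+ 2 = complex.Re z ^+ 2 + complex.Im z ^+ 2.
Proof. by case: z => a b; rewrite /= sqr_sqrtr// addr_ge0 ?sqr_ge0. Qed.

Lemma normc_ge0 (z : R[i]) : 0 <= Normc.normc z.
Proof. by case: z => a b /=; rewrite sqrtr_ge0. Qed.

Lemma normc_sqrE (z : R[i]) : (Normc.normc z ^+ 2)%:C%C = z * z^*%C.
Proof. by rewrite normc_sqr add_Re2_Im2 sqr_normc. Qed.

Lemma normc_cis t : Normc.normc (cis t) = 1.
Proof. by rewrite /= cos2Dsin2 sqrtr1. Qed.

Lemma normc_real (a : R) : 0 <= a -> Normc.normc a%:C%C = a.
Proof. by move=> a0; rewrite /= expr0n addr0 sqrtr_sqr ger0_norm. Qed.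

Definition adjmx m n (A : 'M[R[i]]_(m, n)) : 'M[R[i]]_(n, m) :=
  (map_mx (@conjc R) A)^T.

Lemma adjmxE m n (A : 'M[R[i]]_(m, n)) i j : adjmx A i j = (A j i)^*%C.
Proof. by rewrite !mxE. Qed.

Lemma adjmx_mul m n p (A : 'M[R[i]]_(m, n)) (B : 'M[R[i]]_(n, p)) :
  adjmx (A *m B) = adjmx B *m adjmx A.
Proof. by rewrite /adjmx map_mxM trmx_mul. Qed.

Lemma adjmxK m n (A : 'M[R[i]]_(m, n)) : adjmx (adjmx A) = A.
Proof. by apply/matrixP => i j; rewrite !mxE conjcK. Qed.

Lemma l2norm_ge0 m (x : 'cV[R[i]]_m) : 0 <= l2norm x.
Proof. exact: sqrtr_ge0. Qed.

Lemma l2norm_sqr m (x : 'cV[R[i]]_m) :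
  l2norm x ^+ 2 = \sum_k Normc.normc (x k 0) ^+ 2.
Proof. by rewrite sqr_sqrtr// sumr_ge0// => k _; rewrite sqr_ge0. Qed.

Lemma l2norm_adjmx m (x : 'cV[R[i]]_m) :
  (l2norm x ^+ 2)%:C%C = (adjmx x *m x) 0 0.
Proof.
rewrite l2norm_sqr rmorph_sum mxE; apply: eq_bigr => k _.
by rewrite [LHS]normc_sqrE !mxE mulrC.
Qed.

Lemma l2norm_scaled_isometry m n (A : 'M[R[i]]_(m, n)) (c : R) x :
  adjmx A *m A = c%:C%C%:M -> l2norm (A *m x) ^+ 2 = c * l2norm x ^+ 2.
Proof.
move=> AA; apply: complexI; rewrite l2norm_adjmx adjmx_mul.
rewrite [RHS]rmorphM/= [X in _ = _ * X]l2norm_adjmx.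
by rewrite mulmxA -(mulmxA _ _ A) AA mul_mx_scalar -scalemxAl mxE.
Qed.

Lemma innerE m (x y : 'cV[R[i]]_m) : inner x y = \sum_k x k 0 * (y k 0)^*%C.
Proof.
by rewrite /inner dotmxE mxE; apply: eq_bigr => k _; rewrite !mxE.
Qed.

End ComplexPreliminaries.

(** * Orthogonality relations of the DFT matrix *)

Section Fourier.
Variables (R : realType) (N : nat).
Let U := dft R N.

Lemma dft_cis (k l : 'I_N) : U k l = cis (2 * pi * k%:R * l%:R / N%:R).
Proof. by rewrite !mxE. Qed.

(** Symmetry turns column orthogonality into row orthogonality, the form needed after selecting
    rows. *)
Lemma dft_sym (k l : 'I_N) : U k l = U l k.
Proof.
by rewrite !dft_cis; congr (cis (_ / _)); rewrite -!mulrA (mulrC k%:R).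
Qed.

(** The factor [k] comes first so that [cisMn] turns sums over [k] into geometric sums. *)
Definition phase (i j k : 'I_N) : R :=
  k%:R * (2 * pi * (i%:R - j%:R) / N%:R).

Lemma dft_mul_conj (i j k : 'I_N) : U k i * (U k j)^*%C = cis (phase i j k).
Proof.
by rewrite !dft_cis cis_conj -cisD /phase; congr cis; rewrite -mulNr; ring.
Qed.

Lemma dft_col_orthogonal (i j : 'I_N) :
  \sum_k U k i * (U k j)^*%C = (N%:R * (i == j)%:R)%:C%C.
Proof.
under eq_bigr do rewrite dft_mul_conj cisMn.
have N0 : (N%:R : R) != 0 by rewrite pnatr_eq0; case: N i => // -[].
have [->|neq_ij] := eqVneq i j.
  rewrite subrr mulr0 mul0r cis0 mulr1.
  by under eq_bigr do rewrite expr1n; rewrite sumr_const card_ord rmorph_nat.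
rewrite mulr0; set t := _ / _.
(* The geometric ratio is not 1: since |i - j| < N, the angle lies strictly between -2 pi and 2 pi,
   and it is nonzero. *)
have t1 : cis t != 1.
  apply: contra_neq neq_ij => /cis_eq1 t0.
  have Npos : 0 < (N%:R : R) by rewrite lt_def N0 ler0n.
  have t_eq0 : t = 0.
    have pi2 : 0 < 2 * pi :> R by rewrite mulr_gt0 ?pi_gt0.
    apply: t0; rewrite /t !normrM normfV -normrM (gtr0_norm pi2) normr_nat.
    rewrite ltr_pdivrMr// ltr_pM2l//.
    have := ltn_ord i; have := ltn_ord j; rewrite -!(ltr_nat R) => jN iN.
    have := ler0n R i; have := ler0n R j => j0 i0.
    by rewrite ltr_norml; apply/andP; split; lra.
  apply/val_inj/eqP; rewrite -(eqr_nat R) -subr_eq0.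
  move/eqP: t_eq0; rewrite /t !mulf_eq0 invr_eq0 (negPf N0) orbF.
  by rewrite pnatr_eq0/= (gt_eqF (pi_gt0 R)).
have geo : (cis t - 1) * (\sum_(k < N) cis t ^+ k) = 0.
  rewrite -subrX1 -cisMn (_ : N%:R * t = 2 * pi * i%:R - 2 * pi * j%:R).
    by rewrite cisD -cis_conj !cis_2piM conjc1 mulr1 subrr.
  by rewrite /t; field.
by apply/eqP; move/eqP: geo; rewrite mulf_eq0 subr_eq0 (negPf t1).
Qed.

End Fourier.

(** * Harmonic frames *)

Section HarmonicFrame.
Variables (R : realType) (N : nat) (S : {set 'I_N}).
Hypothesis S_neq0 : S != finset.set0.
Let U := dft R N.
Let F := harmonic_frame R S.

Lemma card_gt0R : 0 < #|S|%:R :> R.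
Proof. by rewrite ltr0n card_gt0. Qed.

Let s_ge0 : 0 <= #|S|%:R :> R.
Proof. exact: ler0n. Qed.

(** All entries of [U] have modulus 1, so all selected columns have the same norm. *)
Lemma harmonic_frameE k n : F k n = U (enum_val k) n / (Num.sqrt #|S|%:R)%:C%C.
Proof.
rewrite mxE [in LHS]mxE; congr (_ / (Num.sqrt _)%:C%C).
under eq_bigr do rewrite !mxE normc_cis expr1n.
by rewrite sumr_const card_ord.
Qed.

Lemma harmonic_frame_mul_conj k l m n :
  F k m * (F l n)^*%C
  = U (enum_val k) m * (U (enum_val l) n)^*%C / (#|S|%:R)%:C%C.
Proof.
rewrite !harmonic_frameE rmorphM fmorphV.
rewrite [X in _ * (_ / X)]conjc_real mulrACA -invfM.
by rewrite -rmorphM/= -expr2 sqr_sqrtr.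
Qed.

Lemma unit_norm_harmonic_frame : unit_norm F.
Proof.
move=> n; apply/eqP; rewrite -(eqrXn2 (n := 2)) ?l2norm_ge0// expr1n.
rewrite l2norm_sqr; apply/eqP/complexI; rewrite rmorph_sum.
rewrite (eq_bigr (fun=> (#|S|%:R%:C%C)^-1)) => [|k _]; last first.
  rewrite [LHS]normc_sqrE [col _ _ _ _]mxE harmonic_frame_mul_conj dft_mul_conj.
  by rewrite /phase subrr mulr0 mul0r mulr0 cis0 div1r.
rewrite sumr_const card_ord -[LHS]mulr_natl rmorph_nat divff//.
by rewrite pnatr_eq0 cards_eq0.
Qed.

Lemma harmonic_frame_operator :
  F *m adjmx F = (N%:R / #|S|%:R)%:C%C%:M.
Proof.
apply/matrixP => k l; rewrite [LHS]mxE [RHS]mxE.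
under eq_bigr do rewrite adjmxE harmonic_frame_mul_conj (dft_sym _ (enum_val k))
  (dft_sym _ (enum_val l)).
rewrite -mulr_suml dft_col_orthogonal -fmorph_div/= (inj_eq enum_val_inj).
by case: eqP => _; rewrite ?mulr1// !mulr0 mul0r.
Qed.

Lemma card_le : #|S|%:R <= N%:R :> R.
Proof. by rewrite ler_nat -[leqRHS]card_ord max_card. Qed.

Lemma redundancy_gt0 : 0 < N%:R / #|S|%:R :> R.
Proof. by rewrite divr_gt0 ?card_gt0R// (lt_le_trans card_gt0R card_le). Qed.

(** A multiple of the adjoint is a right inverse. *)
Lemma is_frame_harmonic_frame : is_frame F.
Proof.
apply/eqP; rewrite -/(row_free F); apply/row_freeP.
exists (((N%:R / #|S|%:R)%:C%C)^-1 *: adjmx F).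
rewrite -scalemxAr harmonic_frame_operator scale_scalar_mx mulVf//.
by rewrite fmorph_eq0 gt_eqF ?redundancy_gt0.
Qed.

(** The left-hand side is the squared norm of [adjmx F *m x]. *)
Lemma harmonic_frame_tight (x : 'cV[R[i]]_#|S|) :
  \sum_(n < N) Normc.normc (inner x (col n F)) ^+ 2
  = N%:R / #|S|%:R * l2norm x ^+ 2.
Proof.
rewrite -(l2norm_scaled_isometry (A := adjmx F)); last first.
  by rewrite adjmxK harmonic_frame_operator.
rewrite l2norm_sqr; apply: eq_bigr => n _; rewrite innerE mxE.
congr (_ _ ^+ 2); apply: eq_bigr => k _.
by rewrite adjmxE [col _ _ _ _]mxE mulrC.
Qed.

Lemma tight_harmonic_frame : tight F.
Proof.
exists (N%:R / #|S|%:R).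
by split; [exact: redundancy_gt0|exact: harmonic_frame_tight].
Qed.

Lemma dft_parseval (x : 'cV[R[i]]_N) :
  l2norm (U *m x) ^+ 2 = N%:R * l2norm x ^+ 2.
Proof.
apply: l2norm_scaled_isometry; apply/matrixP => i j; rewrite [LHS]mxE [RHS]mxE.
under eq_bigr do rewrite adjmxE mulrC.
rewrite dft_col_orthogonal (eq_sym j); case: eqP => _; rewrite ?mulr1//.
by rewrite mulr0.
Qed.

(** Up to scaling, [F *m x] consists of some coordinates of [U *m x], whose norm is given by
    Parseval. *)
Lemma l2norm_harmonic_frame_le (x : 'cV[R[i]]_N) :
  l2norm (F *m x) ^+ 2 <= N%:R / #|S|%:R * l2norm x ^+ 2.
Proof.
rewrite mulrAC -dft_parseval ler_pdivlMr ?card_gt0R// !l2norm_sqr.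
rewrite [leRHS](bigID (mem S))/= ler_wpDr ?sumr_ge0// => [k _|].
  by rewrite sqr_ge0.
rewrite mulr_suml [leRHS]big_enum_val/=; apply: ler_sum => k _.
rewrite [in leLHS]mxE; under eq_bigr do rewrite harmonic_frameE mulrAC.
rewrite -mulr_suml Normc.normcM Normc.normcV normc_real ?sqrtr_ge0//.
rewrite exprMn exprVn sqr_sqrtr// divfK ?gt_eqF ?card_gt0R//.
by rewrite mxE.
Qed.

Lemma spectral_norm_harmonic_frame : spectral_norm F ^+ 2 = N%:R / #|S|%:R.
Proof.
pose c : R := Num.sqrt (N%:R / #|S|%:R).
have c0 : 0 <= c by exact: sqrtr_ge0.
have c2 : c ^+ 2 = N%:R / #|S|%:R by rewrite sqr_sqrtr ?(ltW redundancy_gt0).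
suff -> : spectral_norm F = c by [].
have ub :
  ubound [set l2norm (F *m x) | x in [set x : 'cV[R[i]]_N | l2norm x <= 1]] c.
  move=> _ [x /= x1 <-]; rewrite -(ler_pXn2r (n := 2)) ?nnegrE ?l2norm_ge0//.
  rewrite c2 (le_trans (l2norm_harmonic_frame_le x))//.
  rewrite ler_piMr ?(ltW redundancy_gt0)//.
  by rewrite exprn_ile1 ?l2norm_ge0.
(* The supremum is attained at the normalized conjugate of any row of F. *)
have [k _] : exists k : 'I_#|S|, True.
  have h : (0 < #|S|)%N by rewrite card_gt0.
  by exists (Ordinal h).
pose e : 'cV[R[i]]_#|S| := delta_mx k 0.
have e1 : l2norm e ^+ 2 = 1.
  rewrite l2norm_sqr (bigD1 k)//= mxE !eqxx Normc.normc1 expr1n.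
  rewrite big1 ?addr0// => l lk.
  by rewrite mxE (negPf lk) Normc.normc0 expr0n.
pose x := ((c^-1)%:C)%C *: (adjmx F *m e).
have Fx : F *m x = c%:C%C *: e.
  rewrite -scalemxAr mulmxA harmonic_frame_operator mul_scalar_mx scalerA -c2.
  by rewrite -rmorphM/= expr2 mulKf// gt_eqF// sqrtr_gt0 redundancy_gt0.
have l2normZ m (a : R) (y : 'cV[R[i]]_m) : 
    l2norm (a%:C%C *: y) ^+ 2 = a ^+ 2 * l2norm y ^+ 2.
  rewrite !l2norm_sqr mulr_sumr; apply: eq_bigr => j _.
  by rewrite mxE Normc.normcM exprMn [X in X * _]normc_sqr/= expr0n addr0.
have x1 : l2norm x ^+ 2 = 1.
  rewrite l2normZ (l2norm_scaled_isometry (c := N%:R / #|S|%:R)).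
    rewrite e1 mulr1 -c2 -exprMn mulVf ?expr1n//.
    by rewrite gt_eqF// sqrtr_gt0 redundancy_gt0.
  by rewrite adjmxK harmonic_frame_operator.
have sqr_inj (a b : R) : 0 <= a -> 0 <= b -> a ^+ 2 = b ^+ 2 -> a = b.
  by move=> a0 b0 /eqP; rewrite eqrXn2// => /eqP.
have nx : l2norm x = 1.
  by apply: sqr_inj; rewrite ?l2norm_ge0// x1 expr1n.
apply/eqP; rewrite eq_le; apply/andP; split.
  apply: ge_sup => //; exists (l2norm (F *m x)); exists x => //=.
  by rewrite nx.
apply: ub_le_sup; first by exists c.
exists x => /=; first by rewrite nx.
by apply: sqr_inj => //; rewrite ?l2norm_ge0// Fx l2normZ e1 mulr1.
Qed.

End HarmonicFrame.

(** * The Gram matrix, the Welch bound and the average coherence *)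

Section Coherence.
Variables (R : realType) (N : nat) (S : {set 'I_N}).
Hypothesis S_neq0 : S != finset.set0.
Let U := dft R N.
Let F := harmonic_frame R S.

Let s_gt0 : 0 < #|S|%:R :> R.
Proof. exact: card_gt0R. Qed.

Lemma harmonic_frame_gram i j : inner (col i F) (col j F)
  = (\sum_(k in S) cis (phase R i j k)) / (#|S|%:R)%:C%C.
Proof.
rewrite innerE mulr_suml [RHS]big_enum_val; apply: eq_bigr => k _.
by rewrite [col i _ _ _]mxE [col j _ _ _]mxE harmonic_frame_mul_conj
           // dft_mul_conj.
Qed.

Lemma harmonic_frame_gram_diag i : inner (col i F) (col i F) = 1.
Proof.
have := l2norm_adjmx (col i F).
rewrite (unit_norm_harmonic_frame R S_neq0 i) expr1n mxE => h.
rewrite innerE -[RHS]/((1 : R)%:C%C) h.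
by apply: eq_bigr => k _; rewrite adjmxE mulrC.
Qed.

Let mu := worst_case_coherence F.

Lemma worst_case_coherence_le (b : R) : 0 <= b ->
  (forall i j, j != i -> Normc.normc (inner (col i F) (col j F)) <= b) ->
  mu <= b.
Proof.
move=> b0 Fb; apply: bigmax_le => // i _; apply: bigmax_le => // j.
exact: Fb.
Qed.

Lemma gram_le_worst_case_coherence i j : j != i ->
  Normc.normc (inner (col i F) (col j F)) <= mu.
Proof.
move=> ji; rewrite /mu /worst_case_coherence.
apply: le_trans (le_bigmax _ _ i).
exact: (le_bigmax_cond _ (fun j => Normc.normc (inner (col i F) (col j F)))).
Qed.

(** Tightness tested on one column: the squared moduli in a Gram row sum to [N%:R / #|S|%:R], of
    which the diagonal takes 1. *)
Lemma welch_bound : N%:R / #|S|%:R - 1 <= (N%:R - 1) * mu ^+ 2.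
Proof.
have [i _] : exists i, i \in S by apply/set0Pn.
have tF := harmonic_frame_tight (col i F).
rewrite (unit_norm_harmonic_frame R S_neq0 i) expr1n mulr1 in tF.
rewrite -tF (bigD1 i)//= harmonic_frame_gram_diag Normc.normc1 expr1n.
rewrite addrC addrK.
have -> : (N%:R - 1) * mu ^+ 2 = \sum_(j < N | j != i) mu ^+ 2.
  rewrite sumr_const cardC1 card_ord -[RHS]mulr_natl -subn1 natrB//.
  exact: leq_ltn_trans (leq0n _) (ltn_ord i).
apply: ler_sum => j ji; rewrite lerXn2r ?nnegrE ?normc_ge0//.
  by rewrite (le_trans (normc_ge0 _) (gram_le_worst_case_coherence ji)).
exact: gram_le_worst_case_coherence.
Qed.

(** After exchanging the sums, each frequency [k] in [S] contributes a full row sum of [U], up to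
    conjugation and a phase; it vanishes unless [k] is the zero frequency [o]. *)
Lemma sum_harmonic_frame_gram (o : 'I_N) i : o = 0%N :> nat ->
  \sum_j inner (col i F) (col j F) = (N%:R / #|S|%:R * (o \in S)%:R)%:C%C.
Proof.
move=> o0; under eq_bigr do rewrite harmonic_frame_gram.
rewrite -mulr_suml exchange_big/=.
have rowS k : \sum_j cis (phase R i j k) = (N%:R * (k == o)%:R)%:C%C.
  have Uo j : U j o = 1 by rewrite dft_cis o0 mulr0 mul0r cis0.
  under eq_bigr do rewrite -dft_mul_conj.
  (* Column [o] is constantly 1, so the sum becomes an inner product of columns [o] and [k]. *)
  rewrite -mulr_sumr (eq_bigr (fun j => U j o * (U j k)^*%C)) => [|j _].
    rewrite dft_col_orthogonal eq_sym; case: eqP => [->|_].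
      by rewrite dft_sym Uo mul1r.
    by rewrite mulr0 mulr0.
  by rewrite Uo mul1r dft_sym.
under eq_bigr do rewrite rowS.
rewrite -rmorph_sum -fmorph_div/=; congr (_ %:C)%C.
rewrite mulrAC; congr (_ / _); rewrite -mulr_sumr; congr (_ * _).
rewrite -natr_sum; congr _%:R; case: (boolP (o \in S)) => oS.
  by rewrite (bigD1 o)//= eqxx big1 ?addn0// => k /andP[_ /negPf ->].
by rewrite big1// => k kS; case: eqP => // ko; rewrite -ko kS in oS.
Qed.

(* When #|S| <= N/2, N/#|S| - 1 >= 1 bounds the row sums of the Gram matrix
   whether or not the zero frequency belongs to S. *)
Lemma average_coherence_le : 2 * #|S|%:R <= N%:R :> R ->
  average_coherence F <= (N%:R / #|S|%:R - 1) / (N%:R - 1).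
Proof.
move=> SN; rewrite /average_coherence mulrC.
have q1 : 2 <= N%:R / #|S|%:R :> R by rewrite ler_pdivlMr.
have S1 : 1 <= #|S|%:R :> R by rewrite ler1n card_gt0.
rewrite ler_wpM2r ?invr_ge0 ?subr_ge0//; first lra.
apply: bigmax_le => [|i _]; first by rewrite subr_ge0; lra.
have N0 : (0 < N)%N by exact: leq_ltn_trans (leq0n _) (ltn_ord i).
have := sum_harmonic_frame_gram i (erefl : Ordinal N0 = 0%N :> nat).
rewrite (bigD1 i)//= harmonic_frame_gram_diag.
set s := \sum_(_ | _) _ => h.
have -> : s = (N%:R / #|S|%:R * (Ordinal N0 \in S)%:R - 1)%:C%C.
  by apply: (addrI 1); rewrite h [in RHS]rmorphB rmorph1 addrC subrK.
rewrite /= expr0n addr0 sqrtr_sqr; case: (_ \in S); rewrite ?mulr1 ?mulr0.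
  by rewrite ger0_norm//; lra.
by rewrite sub0r normrN normr1; lra.
Qed.

(** With q = N / |S| - 1, the average coherence is at most q / (N - 1) and mu^2 is at least q / (N -
    1). Squaring, it remains to see that q |S| = N - |S| <= N - 1. *)
Lemma average_coherence_le_worst_case : 2 * #|S|%:R <= N%:R :> R ->
  average_coherence F <= mu / Num.sqrt #|S|%:R.
Proof.
move=> SN; apply: (le_trans (average_coherence_le SN)).
have S1 : 1 <= #|S|%:R :> R by rewrite ler1n card_gt0.
have N1 : 0 < N%:R - 1 :> R by lra.
have q1 : 2 <= N%:R / #|S|%:R :> R by rewrite ler_pdivlMr.
have mu0 : 0 <= mu.
  rewrite /mu /worst_case_coherence.
  by elim/big_rec: _ => // i x _ x0; rewrite le_max x0 orbT.
have := welch_bound; set q := _ - 1 => welch.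
have q0 : 0 <= q by rewrite subr_ge0; lra.
have qS : q * #|S|%:R <= N%:R - 1.
  by rewrite /q mulrBl divfK ?gt_eqF// mul1r lerD2l lerN2.
rewrite -(ler_pXn2r (n := 2)) ?nnegrE ?divr_ge0 ?sqrtr_ge0 ?(ltW N1)//.
rewrite !expr_div_n sqr_sqrtr ?ler0n//.
rewrite ler_pdivrMr ?exprn_gt0// mulrAC ler_pdivlMr//.
rewrite [leLHS](_ : _ = q * (q * #|S|%:R)); last by rewrite expr2 mulrA.
apply: (le_trans (ler_wpM2l q0 qS)).
rewrite [leRHS](_ : _ = ((N%:R - 1) * mu ^+ 2) * (N%:R - 1)); last by ring.
by rewrite ler_wpM2r ?(ltW N1).
Qed.

End Coherence.

(** * Tail bounds *)

Section CoherenceTail.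
Variables (R : realType) (N : nat) (S : {set 'I_N}) (p : R).
Hypothesis S_neq0 : S != finset.set0.
Let F := harmonic_frame R S.

Lemma sum_cis_phase (A : {set 'I_N}) i j :
  \sum_(k in A) cis (phase R i j k)
  = ((\sum_(k in A) cos (phase R i j k))
     +i* (\sum_(k in A) sin (phase R i j k)))%C.
Proof.
by apply: (big_ind3 (fun z a b => z = (a +i* b)%C)) => // _ a b _ c d -> ->.
Qed.

(** Orthogonality of distinct DFT columns makes the full cosine and sine sums vanish, so the sums
    over [S] are already centered, whatever [p] is. *)
Lemma normc_gram_offdiag i j : i != j ->
  (Normc.normc (inner (col i F) (col j F)) * #|S|%:R) ^+ 2
  = centered_sum p (fun k => cos (phase R i j k)) S ^+ 2
    + centered_sum p (fun k => sin (phase R i j k)) S ^+ 2.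
Proof.
move=> ij; have s_gt0 := card_gt0R R S_neq0.
have [cos0 sin0] :
  \sum_k cos (phase R i j k) = 0 /\ \sum_k sin (phase R i j k) = 0.
  have := dft_col_orthogonal R i j.
  under eq_bigr do rewrite dft_mul_conj.
  rewrite (negPf ij) mulr0.
  rewrite (eq_bigl (fun k => k \in [set: 'I_N]%SET)); last first.
    by move=> k; rewrite finset.in_setT.
  rewrite sum_cis_phase => -[c0 s0].
  by split; [move: c0|move: s0]; under eq_bigl do rewrite finset.in_setT.
rewrite harmonic_frame_gram// Normc.normcM Normc.normcV normc_real ?ler0n//.
rewrite divfK ?gt_eqF// normc_sqr sum_cis_phase !centered_sumE cos0 sin0.
by rewrite mulr0 !subr0.
Qed.

Lemma worst_case_coherence_le_tail (s : R) :
  (forall i j, `|centered_sum p (fun k => cos (phase R i j k)) S| <= s) ->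
  (forall i j, `|centered_sum p (fun k => sin (phase R i j k)) S| <= s) ->
  worst_case_coherence F <= Num.sqrt (2 * s ^+ 2) / #|S|%:R.
Proof.
move=> hcos hsin; have s_gt0 := card_gt0R R S_neq0.
apply: worst_case_coherence_le => [|i j]; first by rewrite divr_ge0 ?sqrtr_ge0.
rewrite eq_sym => ij; rewrite ler_pdivlMr//.
rewrite -(ler_pXn2r (n := 2))
  ?nnegrE ?mulr_ge0 ?normc_ge0 ?sqrtr_ge0 ?(ltW s_gt0)//.
have s0 : 0 <= s by apply: le_trans (hcos i j).
rewrite [leRHS]sqr_sqrtr ?mulr_ge0 ?sqr_ge0//.
rewrite (normc_gram_offdiag ij) mulr_natl mulr2n.
by rewrite -(real_normK (num_real (centered_sum p _ S)))
           -(real_normK (num_real (centered_sum p (fun k => sin _) S)))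
           lerD// lerXn2r ?nnegrE.
Qed.

End CoherenceTail.

(** * Choice of the parameters and the union bound *)

Section CoherenceParameters.
Variables (R : realType) (N M : nat).
Hypothesis M_gt0 : (0 < M)%N.
Hypothesis ln_le : 16 * ln N%:R <= M%:R :> R.
Hypothesis M_le : M%:R <= N%:R / 3 :> R.
Let n : R := N%:R.
Let m : R := M%:R.
Let L : R := ln n.
Let p : R := m / n.

Let m_ge1 : 1 <= m. Proof. by rewrite ler1n. Qed.
Let n_gt0 : 0 < n.
Proof. by have := m_ge1; move: M_le; rewrite -/n -/m; lra. Qed.

Lemma expR_lnN : expR L = n.
Proof. by rewrite lnK. Qed.

(** From N >= 3 and ln N >= 1 - 1 / N one gets M >= 32 / 3, hence N >= 32. The value 4 suffices to
    absorb a factor 2 into the square root of N. *)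
Lemma N_ge4 : 4 <= n.
Proof.
have n3 : 3 <= n by have := m_ge1; move: M_le; rewrite -/n -/m; lra.
have L1 : 2 / 3 <= L.
  have := expR_ge1Dx (- L); rewrite expRN expR_lnN => h.
  have : n^-1 <= 3^-1 by rewrite lef_pV2 ?posrE.
  by lra.
by move: ln_le M_le; rewrite -/n -/m -/L; lra.
Qed.

Lemma lnN_gt0 : 0 < L.
Proof. by rewrite ln_gt0// (lt_le_trans _ N_ge4)//; lra. Qed.

Lemma mean_in01 : 0 <= p <= 1.
Proof.
have m0 : 0 <= m by exact: ler0n.
rewrite /p divr_ge0 ?(ltW n_gt0)//= ler_pdivrMr// mul1r.
by move: M_le; rewrite -/n -/m; lra.
Qed.

Definition total_variance : R := m * (n - m) / n.

Lemma total_varianceE : n * (p * (1 - p)) = total_variance.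
Proof. by rewrite /total_variance /p; field; rewrite gt_eqF. Qed.

Lemma total_variance_bounds : 2 / 3 * m <= total_variance <= m.
Proof.
rewrite /total_variance ler_pdivlMr// ler_pdivrMr//.
have := m_ge1; have := n_gt0; move: M_le; rewrite -/n -/m => h1 h2 h3.
by apply/andP; split; nra.
Qed.

(** The exponent is at most M / 16 - M / 8 = - M / 16, and 16 ln N <= M bounds this by - ln N. *)
Lemma size_exponent :
  expR ((1 / 4) ^+ 2 * (n * (p * (1 - p))) - 1 / 4 * (m / 2)) <= n^-1.
Proof.
rewrite -[in leRHS]expR_lnN -expRN ler_expR total_varianceE.
have /andP[_ vm] := total_variance_bounds.
move: ln_le; rewrite -/n -/m -/L; lra.
Qed.

(* With both coordinates of a Gram sum below [deviation] and #|S| >= M / 2, the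
   coherence is at most sqrt (2 * deviation^2) / (M / 2), which is the stated
   bound since 118 = 8 * (59 / 4). *)
Definition deviation : R := Num.sqrt (59 / 4 * (total_variance * L)).

(* The minimizer of l^2 * total_variance - l * deviation. *)
Definition tilt : R := deviation / (2 * total_variance).

Lemma total_variance_gt0 : 0 < total_variance.
Proof. by have /andP[+ _] := total_variance_bounds; have := m_ge1; lra. Qed.

Lemma deviation_sqr : deviation ^+ 2 = 59 / 4 * (total_variance * L).
Proof.
by have := mulr_gt0 total_variance_gt0 lnN_gt0 => h; rewrite sqr_sqrtr//; lra.
Qed.

(** Here [tilt ^+ 2] is 59 / 16 times [L / total_variance], and this ratio is at most 3 / 32; the
    product 177 / 512 is just below 9 / 25. *)
Lemma tilt_bounds : 0 <= tilt <= 3 / 5.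
Proof.
have v0 := total_variance_gt0.
have d0 : 0 < 2 * total_variance by lra.
rewrite divr_ge0 ?sqrtr_ge0 ?(ltW d0)//= ler_pdivrMr//.
have r0 : 0 <= 3 / 5 * (2 * total_variance) by lra.
rewrite -(ler_pXn2r (n := 2)) ?nnegrE ?sqrtr_ge0// deviation_sqr.
have /andP[vm _] := total_variance_bounds.
have : 32 / 3 * L <= total_variance by move: ln_le; rewrite -/n -/m -/L; lra.
by move=> vL; nra.
Qed.

Lemma coherence_exponent :
  expR (tilt ^+ 2 * (n * (p * (1 - p))) - tilt * deviation) <= (2 * n ^+ 3)^-1.
Proof.
rewrite total_varianceE.
have -> : tilt ^+ 2 * total_variance - tilt * deviation
    = - (deviation ^+ 2 / (4 * total_variance)).
  by rewrite /tilt; field; rewrite gt_eqF// total_variance_gt0.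
rewrite deviation_sqr.
have -> : 59 / 4 * (total_variance * L) / (4 * total_variance) = 59 / 16 * L.
  by field; rewrite gt_eqF// total_variance_gt0.
rewrite expRN lef_pV2 ?posrE ?expR_gt0 ?mulr_gt0 ?exprn_gt0//.
have L0 := lnN_gt0.
(* Since 59 / 16 exceeds 7 / 2, there is room for N^3 and for an extra square root of N, which is at
   least 2. *)
apply: (@le_trans _ _ (expR (L / 2 + 3%:R * L))); last by rewrite ler_expR; lra.
rewrite expRD expRM_natl expR_lnN ler_pM2r ?exprn_gt0//.
rewrite -(ler_pXn2r (n := 2)) ?nnegrE ?expR_ge0// -expRM_natl.
rewrite [2 * _](_ : _ = L); last by field.
by rewrite expR_lnN; have := N_ge4; lra.
Qed.

(** The event of the theorem as a property of a fixed subset, so that its probability is a sum of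
    [bernoulli_law]. *)
Definition favorable (A : {set 'I_N}) : Prop :=
  let F := harmonic_frame R A in
  [/\ m / 2 <= #|A|%:R :> R /\ #|A|%:R <= 3 / 2 * m :> R,
      average_coherence F <= worst_case_coherence F / Num.sqrt #|A|%:R &
      worst_case_coherence F <= Num.sqrt (118 * (n - m) * L / (m * n))].

(* The index [inl _] tests the size of the random set; [inr (i, j, b)] tests the
   real or imaginary part of the Gram entry (i, j). *)
Definition test_fun (e : unit + 'I_N * 'I_N * bool) : 'I_N -> R :=
  match e with
  | inl _ => fun=> 1
  | inr (i, j, b) =>
      fun k => if b then cos (phase R i j k) else sin (phase R i j k)
  end.

Definition threshold (e : unit + 'I_N * 'I_N * bool) : R :=
  if e is inl _ then m / 2 else deviation.

Lemma favorable_of_tests (A : {set 'I_N}) :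
  (forall e, `|centered_sum p (test_fun e) A| < threshold e) -> favorable A.
Proof.
move=> h.
have [sz1 sz2] : m / 2 <= #|A|%:R :> R /\ #|A|%:R <= 3 / 2 * m :> R.
  have := h (inl tt); rewrite centered_sumE /= !sumr_const card_ord -/n.
  by rewrite divfK ?gt_eqF// ltr_norml => /andP[]; lra.
have A0 : A != finset.set0.
  by rewrite -card_gt0 -(ltr0n R); have := m_ge1; lra.
split=> //.
  (* The size bound and M <= N / 3 give |A| <= 3 M / 2 <= N / 2. *)
  apply: average_coherence_le_worst_case => //.
  by move: M_le; rewrite -/n -/m; lra.
apply: le_trans
  (worst_case_coherence_le_tail (p := p) (s := deviation) A0 _ _) _.
- by move=> i j; apply/ltW/(h (inr (i, j, true))).
- by move=> i j; apply/ltW/(h (inr (i, j, false))).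
have Ap := card_gt0R R A0.
have vL := mulr_gt0 total_variance_gt0 lnN_gt0; have m1 := m_ge1.
have mA : (m / 2) ^+ 2 <= #|A|%:R ^+ 2 by rewrite lerXn2r ?nnegrE//; lra.
have -> : 118 * (n - m) * L / (m * n) = 118 * (total_variance * L) / m ^+ 2.
  by rewrite /total_variance; field; rewrite !gt_eqF//; lra.
rewrite ler_pdivrMr//.
rewrite -(ler_pXn2r (n := 2)) ?nnegrE ?mulr_ge0 ?sqrtr_ge0 ?(ltW Ap)//.
rewrite exprMn deviation_sqr !sqr_sqrtr; last 2 first.
- by rewrite divr_ge0 ?sqr_ge0//; lra.
- by lra.
(* Both 2 * 59 / 4 and 118 / 4 equal 59 / 2, so the first inequality is an equality. *)
apply: (@le_trans _ _ (118 * (total_variance * L) / m ^+ 2 * (m / 2) ^+ 2)).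
  by rewrite le_eqVlt; apply/orP; left; apply/eqP; field; rewrite gt_eqF//; lra.
by rewrite ler_wpM2l// divr_ge0 ?sqr_ge0//; lra.
Qed.

Lemma unfavorable_mass :
  \sum_(A | ~~ `[< favorable A >]) bernoulli_law p A <= 4 * n^-1.
Proof.
have p01 := mean_in01.
apply: (le_trans (bernoulli_law_union p01 (Q := fun A => ~~ `[< favorable A >])
  (E := fun e A => threshold e <= `|centered_sum p (test_fun e) A|) _)).
  move=> A; apply: contraNP => nobad; apply/asboolP/favorable_of_tests => e.
  by rewrite ltNge; apply/negP => he; apply: nobad; exists e.
rewrite big_sumType/=.
have n0 := n_gt0.
have c1 e k : `|test_fun e k| <= 1.
  case: e => [u|[[i j] []]] /=; first by rewrite normr1.
    by rewrite ler_norml cos_geN1 cos_le1.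
  by rewrite ler_norml sin_geN1 sin_le1.
have card_n : #|'I_N|%:R = n by rewrite card_ord.
(* One size test fails with mass at most 2 / N; each of the 2 N^2 Gram tests, diagonal pairs
   included, fails with mass at most N^-3. *)
have -> : 4 * n^-1 = 2 * n^-1 + (2 * (2 * n ^+ 3)^-1) *+ (N * N * 2).
  by rewrite -[X in _ = _ + X]mulr_natr !natrM -/n; field; rewrite gt_eqF.
apply: lerD.
  rewrite (big_pred1 tt) => [|[]]//.
  apply: le_trans
    (bernoulli_law_norm_tail p01 (l := 1 / 4) _ (c1 (inl tt)) _) _.
    by lra.
  by rewrite ler_wpM2l// card_n size_exponent.
apply: (@le_trans _ _ (\sum_(e : 'I_N * 'I_N * bool) 2 * (2 * n ^+ 3)^-1)).
  apply: ler_sum => e _.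
  apply: le_trans (bernoulli_law_norm_tail p01 _ (c1 (inr e)) tilt_bounds) _.
  by rewrite ler_wpM2l// card_n coherence_exponent.
by rewrite sumr_const !card_prod card_ord card_bool.
Qed.

(** The positive term [(n ^+ 2)^-1] makes the inequality strict. *)
Lemma favorable_mass :
  1 - 4 * n^-1 - (n ^+ 2)^-1 < \sum_(A | `[< favorable A >]) bernoulli_law p A.
Proof.
have := bernoulli_law_total 'I_N p.
rewrite (bigID (fun A => `[< favorable A >]))/= => tot.
have := unfavorable_mass.
have : 0 < (n ^+ 2)^-1 by rewrite invr_gt0 exprn_gt0.
lra.
Qed.

End CoherenceParameters.

Theorem theorem3 (R : realType) (d : measure_display) (T : measurableType d)
    (P : probability T R) (M N : nat) (B : 'I_N -> {RV P >-> bool})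
    (M_gt0 : (0 < M)%N) (leMN : (M <= N)%N)
    (indepB : mutually_independent B)
    (bernB : forall i : 'I_N, bernoulli_RV (M%:R / N%:R) (B i)) :
  (forall w : T, random_index_set B w != finset.set0 ->
     let S := random_index_set B w in
     let F := harmonic_frame R S in
     [/\ is_frame F, unit_norm F, tight F &
         spectral_norm F ^+ 2 = N%:R / #|S|%:R]) /\
  (16 * ln N%:R <= M%:R :> R -> M%:R <= N%:R / 3 :> R ->
   let E : set T := [set w |
     let S := random_index_set B w in
     let F := harmonic_frame R S in
     [/\ M%:R / 2 <= #|S|%:R :> R /\ #|S|%:R <= 3 / 2 * M%:R :> R,
         average_coherence F <= worst_case_coherence F / Num.sqrt #|S|%:R &
         worst_case_coherence F <=
           Num.sqrt (118 * (N%:R - M%:R) * ln N%:R / (M%:R * N%:R))]] in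
   measurable E /\
   ((1 - 4 * N%:R^-1 - (N%:R ^+ 2)^-1)%:E < P E)%E).
Proof.
split=> [w S0|ln_le M_le E].
  split; [exact: is_frame_harmonic_frame|exact: unit_norm_harmonic_frame|
          exact: tight_harmonic_frame|exact: spectral_norm_harmonic_frame].
pose Q : set {set 'I_N} := @favorable R N M.
rewrite (_ : E = [set w | Q (random_index_set B w)])//.
split; first exact: measurable_random_index_set.
rewrite (prob_random_index_set (mean_in01 M_gt0 M_le) indepB bernB) lte_fin.
exact: favorable_mass.
Qed.
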